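(* Let $q\in(0,1)$, $n\ge1$, and let $a,b\in\mathbb{R}$ satisfy $0<aq<1$ and $bq<1$. Then $p_n(x;a,b)\in\mathbb{P}_n^q((0,1))$, and the following interlacing holds: (i) $p_n(x;a,b)\prec p_{n-1}(x;qa,qb)$; (ii) $p_n(x;a,q^2b)\prec p_n(x;q^2a,b)$. Additionally, if $b<0$, then (iii) $p_n(x;a,b)\prec p_n(x;a,q^2b)$.
   Context: For $c\in\mathbb{C}$ and an integer $j\ge0$, $(c;q)_0:=1$ and $(c;q)_j:=\prod_{i=0}^{j-1}(1-cq^i)$. The little $q$-Jacobi polynomial of degree $n$ with parameters $a,b$ is $$p_n(x;a,b)=p_n(x;a,b|q):=\sum_{j=0}^n\frac{(q^{-n};q)_j\,(abq^{n+1};q)_j}{(aq;q)_j\,(q;q)_j}\,(qx)^j .$$ Zeros of a real-rooted polynomial $p$ of degree $n$ are listed with multiplicity as $\lambda_1(p)\le\dots\le\lambda_n(p)$. Logarithmic mesh: for a polynomial $p$ of degree $n\ge2$ with all zeros positive, $\operatorname{lmesh}(p):=\max_{1\le j\le n-1}\lambda_j(p)/\lambda_{j+1}(p)$. For $K\subset(0,\infty)$, $\mathbb{P}_n^q(K)$ is the set of polynomials of degree $n$ with all zeros in $K$ and with $\operatorname{lmesh}(p)<q$ (for $n=1$ the condition on the logarithmic mesh is vacuous). Strict interlacing: for real-rooted polynomials $p$ of degree $n$ and $r$ of degree $m$, $p\prec r$ means that either $m=n$ and $\lambda_1(p)<\lambda_1(r)<\lambda_2(p)<\lambda_2(r)<\dots<\lambda_n(p)<\lambda_n(r)$,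 or $m=n-1$ and $\lambda_1(p)<\lambda_1(r)<\lambda_2(p)<\dots<\lambda_{n-1}(p)<\lambda_{n-1}(r)<\lambda_n(p)$ (vacuous if $m=0$). *)

(* Defs.v *)
From mathcomp Require Import all_boot all_order all_algebra.
From mathcomp Require Import boolp classical_sets set_interval reals.

Set Implicit Arguments.
Unset Strict Implicit.
Unset Printing Implicit Defensive.

Import Order.TTheory GRing.Theory Num.Theory.
Local Open Scope ring_scope.
Local Open Scope classical_set_scope.

(* (c; q)_j *)
Definition qpoch (F : fieldType) (c q : F) (j : nat) : F :=
  \prod_(i < j) (1 - c * q ^+ i).

(* p_n(x; a, b | q) *)
Definition little_qjacobi (F : fieldType) (q : F) (n : nat) (a b : F) :
    {poly F} :=
  \sum_(j < n.+1)
    (qpoch (q ^- n) q j * qpoch (a * b * q ^+ n.+1) q j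
       / (qpoch (a * q) q j * qpoch q q j)) *: (q *: 'X) ^+ j.

Section Zeros.
Variable R : realType.
Implicit Types (p r : {poly R}) (s : seq R) (K : set R).

Definition degree p : nat := (size p).-1.

Definition is_zero_list p s : Prop :=
  [/\ p != 0, sorted <=%R s
    & p = lead_coef p *: \prod_(z <- s) ('X - z%:P)].

Definition real_rooted p : Prop := exists s, is_zero_list p s.

(* Default value [::] when p is not real-rooted. *)
Definition zeros p : seq R := xget [::] [set s | is_zero_list p s].

(* Indexed from 0: [lambda p j] is the (j+1)-st smallest zero. *)
Definition lambda p (j : nat) : R := (zeros p)`_j.

(* The maximum is taken over positive ratios when all zeros are positive, so
   starting it from 0 is harmless. *)
Definition lmesh p : R :=
  \big[Num.max/0]_(j < (degree p).-1) (lambda p j / lambda p j.+1).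

(* The class P_n^q(K), for K included in (0, +oo). *)
Definition mesh_class (q : R) (n : nat) K : set {poly R} :=
  [set p | [/\ real_rooted p, degree p = n, (forall z, root p z -> K z)
             & (1 < n)%N -> lmesh p < q]].

Definition interlace p r : Prop :=
  [/\ real_rooted p, real_rooted r &
      (degree r = degree p
       /\ (forall j, (j < degree p)%N -> lambda p j < lambda r j)
       /\ (forall j, (j.+1 < degree p)%N -> lambda r j < lambda p j.+1))
   \/ ((degree r).+1 = degree p
       /\ (forall j, (j < degree r)%N ->
             lambda p j < lambda r j /\ lambda r j < lambda p j.+1))].

Lemma zerosE p s : is_zero_list p s -> zeros p = s.
Proof.
move=> ps; rewrite /zeros; case: xgetP => [t _ /= pt|]; last by move/(_ s).
case: ps => p0 ss ps; case: pt => _ st pt.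
have lc0 : lead_coef p != 0 by rewrite lead_coef_eq0.
apply: (sorted_eq le_trans le_anti st ss).
exact/prod_XsubC_eq/(scalerI lc0)/(etrans (esym pt) ps).
Qed.

End Zeros.

Notation "p ≺ r" := (interlace p r) (at level 70, no associativity).

(* Main.v *)
Require Import Defs.
From mathcomp Require Import all_boot all_order all_algebra.
From mathcomp Require Import boolp classical_sets set_interval reals.
From mathcomp Require Import ring lra.

Set Implicit Arguments.
Unset Strict Implicit.
Unset Printing Implicit Defensive.

(** The zeros are located by sign changes, propagated by q-difference relations.

    Write [p_n(x; a, b)] for the little q-Jacobi polynomial and [T] for the
    dilation [(T f)(x) = f(q x)].  Comparing coefficients gives four identities:
    the backward shift ([backward_shift]), which writes
    [(1 - a q) p_(n+1)(q x; a, b)] as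
    [(1 - q x) r(x) - a q (1 - b q^2 x) r(q x)] with [r = p_n(x; q a, q b)];
    the two first-order relations [shift_a] and [shift_b], in which
    [p_n(x; a, q b)] is, up to a constant factor, [1 - a q T] applied to
    [p_n(x; q a, b)], and [1 - a b q^(n+1) T] applied to [p_n(x; a, b)];
    and the second-order q-difference equation ([qdiff_eq]).

    A logarithmic mesh below [q] says that [q s_j] and [s_j / q] stay between
    the zeros next to [s_j], so the signs of the polynomial at these points are
    known.  Feeding the zeros [s_1 < ... < s_n] of [r] to the backward shift then
    yields the signs of [p_(n+1)] at [0 < q s_1 < s_1 < q s_2 < ... < s_n < 1].
    One zero lies in each of the intervals from [0] to [q s_1], from [s_(j-1)]
    to [q s_j] and from [s_n] to [1]; this is at once the interlacing (i) and
    the mesh bound for [p_(n+1)].  Induction on [n]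
    gives the membership in the mesh class ([mesh_zeros_step]).

    For (ii) and (iii) one first-order relation is used twice, which writes
    [p_n(x; a, q^2 b)] as a second-order expression in [T] applied to
    [r = p_n(x; q^2 a, b)], resp. [r = p_n(x; a, b)].  At a zero [x] of [r] only
    [r(q x)] and [r(q^2 x)] remain; the q-difference equation makes
    [r(q^2 x)] a multiple of [r(q x)], whose sign is known from the mesh, and an
    elementary estimate shows that the total factor has a constant sign
    ([interlace_ab], [interlace_b]). *)

Import Order.TTheory GRing.Theory Num.Theory.
Local Open Scope ring_scope.
Local Open Scope classical_set_scope.

(** * Coefficient identities *)

Section Identities.
Variables (F : fieldType) (q : F).
Implicit Types (a b c : F) (n j : nat) (p : {poly F}).

Lemma qpochS c j : qpoch c q j.+1 = qpoch c q j * (1 - c * q ^+ j).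
Proof. by rewrite /qpoch big_ord_recr. Qed.

Lemma qpoch0 c : qpoch c q 0 = 1.
Proof. by rewrite /qpoch big_ord0. Qed.

Lemma qpochSl c j : qpoch c q j.+1 = (1 - c) * qpoch (c * q) q j.
Proof.
rewrite /qpoch big_ord_recl /= expr0 mulr1; congr (_ * _).
by apply: eq_bigr => i _; rewrite /bump /= add1n exprS mulrA.
Qed.

Lemma qpoch_shift c j :
  (1 - c) * qpoch (c * q) q j = qpoch c q j * (1 - c * q ^+ j).
Proof. by rewrite -qpochSl qpochS. Qed.

Definition dilate p : {poly F} := p \Po (q *: 'X).

Lemma horner_dilate p x : (dilate p).[x] = p.[q * x].
Proof. by rewrite /dilate horner_comp hornerZ hornerX. Qed.

Lemma coef_dilate p j : (dilate p)`_j = q ^+ j * p`_j.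
Proof.
rewrite /dilate comp_polyE.
under eq_bigr => i _ do rewrite exprZn scalerA.
rewrite -(poly_def _ (fun i => p`_i * q ^+ i)) coef_poly mulrC.
by case: ltnP => // ?; rewrite nth_default ?mulr0.
Qed.

Hypothesis q_neq0 : q != 0.
Hypothesis qq_neq0 : forall j, 1 - q * q ^+ j != 0.

Lemma qpoch_neq0 c j : (forall i, 1 - c * q ^+ i != 0) -> qpoch c q j != 0.
Proof. by move=> h; rewrite /qpoch prodf_seq_neq0; apply/allP => i _ /=. Qed.

Lemma little_qjacobi_poly n a b :
  little_qjacobi q n a b =
  \poly_(j < n.+1) (qpoch (q ^- n) q j * qpoch (a * b * q ^+ n.+1) q j
                      / (qpoch (a * q) q j * qpoch q q j) * q ^+ j).
Proof.
by rewrite poly_def; apply: eq_bigr => j _; rewrite exprZn scalerA.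
Qed.

Lemma size_little_qjacobi n a b : (size (little_qjacobi q n a b) <= n.+1)%N.
Proof. by rewrite little_qjacobi_poly size_poly. Qed.

(** The closed form extends past the degree, because [(q^-n; q)_j] vanishes for
    [j > n]; so coefficients may be compared without bounding the index. *)
Lemma coef_little_qjacobi n a b j :
  (little_qjacobi q n a b)`_j =
  qpoch (q ^- n) q j * qpoch (a * b * q ^+ n.+1) q j
    / (qpoch (a * q) q j * qpoch q q j) * q ^+ j.
Proof.
rewrite little_qjacobi_poly coef_poly; case: ltnP => // nj.
rewrite {1}/qpoch (bigD1 (Ordinal nj)) //= mulVf ?expf_neq0 //.
by rewrite subrr !mul0r.
Qed.

Lemma horner0_little_qjacobi n a b : (little_qjacobi q n a b).[0] = 1.
Proof.
by rewrite horner_coef0 coef_little_qjacobi !qpoch0 expr0 !(mulr1, invr1).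
Qed.

Lemma coefS_little_qjacobi n a b j (p := little_qjacobi q n a b) :
  1 - a * q * q ^+ j != 0 ->
  p`_j.+1 * ((1 - a * q * q ^+ j) * (1 - q * q ^+ j)) =
  p`_j * ((1 - q ^- n * q ^+ j) * (1 - a * b * q ^+ n.+1 * q ^+ j) * q).
Proof.
move=> aj; rewrite /p !coef_little_qjacobi !qpochS !invfM (exprS q j).
have qj := qq_neq0 j.
(* As opaque inverses these need not be nonzero for field. *)
set u := (qpoch (a * q) q j)^-1; set v := (qpoch q q j)^-1; set w := q ^- n.
by field; rewrite qj aj.
Qed.

(** This is the coefficient form of the fact that the q-derivative of
    [p_(n+1)(x; a, b)] is a multiple of [p_n(x; q a, q b)]. *)
Lemma coefS_backward n a b j :
  1 - a * q != 0 ->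
  (little_qjacobi q n.+1 a b)`_j.+1 * ((1 - a * q) * (1 - q * q ^+ j)) =
  (little_qjacobi q n (q * a) (q * b))`_j *
    ((1 - q ^- n.+1) * (1 - a * b * q ^+ n.+2) * q).
Proof.
move=> a0; rewrite !coef_little_qjacobi.
rewrite (qpochSl (q ^- _)) (qpochSl (a * b * _)) (qpochSl (a * q)) qpochS.
have -> : q ^- n.+1 * q = q ^- n.
  by rewrite exprS; field; rewrite q_neq0 expf_neq0.
have -> : q * a * (q * b) * q ^+ n.+1 = a * b * q ^+ n.+2 * q.
  by rewrite !exprS; ring.
rewrite (mulrC q a) !invfM (exprS q j).
have qj := qq_neq0 j.
set u := (qpoch (a * q * q) q j)^-1; set v := (qpoch q q j)^-1.
set w := q ^- n.+1.
by field; rewrite qj a0.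
Qed.

(** Stated for the dilated polynomial, so that the right-hand side is evaluated
    at [x] and [q x] and never at [x / q]. *)
Lemma backward_shift n a b (p := little_qjacobi q n.+1 a b)
    (r := little_qjacobi q n (q * a) (q * b)) :
  (forall j, 1 - a * q * q ^+ j != 0) ->
  (1 - a * q) *: dilate p =
  (1 - q *: 'X) * r - (a * q) *: ((1 - (b * q ^+ 2) *: 'X) * dilate r).
Proof.
move=> h; apply/polyP => j.
have a0 : 1 - a * q != 0 by have := h 0%N; rewrite expr0 mulr1.
rewrite !mulrBl !mul1r -!scalerAl !(coefZ, coefB, coefXM, coef_dilate).
case: j => [|j] /=.
  rewrite expr0 -!horner_coef0 !horner0_little_qjacobi.
  by ring.
have qj := qq_neq0 j; have hj := h j.+1.
have E1 := coefS_backward n b j a0.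
have E2 : r`_j.+1 * ((1 - a * q * q ^+ j.+1) * (1 - q * q ^+ j)) =
    r`_j * ((1 - q ^- n * q ^+ j) * (1 - a * b * q ^+ n.+3 * q ^+ j) * q).
  have := @coefS_little_qjacobi n (q * a) (q * b) j.
  rewrite (_ : q * a * q * q ^+ j = a * q * q ^+ j.+1).
    2: by rewrite exprS; ring.
  rewrite (_ : q * a * (q * b) * q ^+ n.+1 = a * b * q ^+ n.+3).
    by apply.
  by rewrite !exprS; ring.
set x := p`_j.+1 in E1 *; set y := r`_j.+1 in E2 *.
set z := r`_j in E1 E2 *.
apply: (mulIf qj).
have -> : (1 - a * q) * (q ^+ j.+1 * x) * (1 - q * q ^+ j) =
  q ^+ j.+1 * (x * ((1 - a * q) * (1 - q * q ^+ j))) by ring.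
rewrite E1.
have -> : (y - q * z - a * q * (q ^+ j.+1 * y - b * q ^+ 2 * (q ^+ j * z))) *
 (1 - q * q ^+ j) = y * ((1 - a * q * q ^+ j.+1) * (1 - q * q ^+ j))
  - (q - a * q * b * q ^+ 2 * q ^+ j) * z * (1 - q * q ^+ j) by ring.
rewrite E2 !exprS.
by field; rewrite q_neq0 expf_neq0.
Qed.

(** On the monomial of degree [j], [1 - a q T] acts as [1 - a q q^j], which
    turns [(a q^2; q)_j] in the denominator into [(a q; q)_j]; the product of
    the two parameters is the same on both sides. *)
Lemma shift_a n a b :
  (forall j, 1 - a * q * q ^+ j != 0) ->
  (1 - a * q) *: little_qjacobi q n a (q * b) =
  little_qjacobi q n (q * a) b
    - (a * q) *: dilate (little_qjacobi q n (q * a) b).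
Proof.
move=> h; apply/polyP => j.
have a0 : 1 - a * q != 0 by have := h 0%N; rewrite expr0 mulr1.
rewrite !(coefZ, coefB, coef_dilate) !coef_little_qjacobi.
rewrite (_ : q * a * b = a * (q * b)); last by ring.
have E := qpoch_shift (a * q) j.
rewrite (mulrC q a).
have h1 : qpoch (a * q) q j != 0 by exact: qpoch_neq0.
have h2 : qpoch (a * q * q) q j != 0.
  by apply: qpoch_neq0 => i; have := h i.+1; rewrite exprS !mulrA.
have h3 : qpoch q q j != 0 by exact: qpoch_neq0.
set u := qpoch (a * q) q j in E h1 *; set v := qpoch (a * q * q) q j in E h2 *.
have -> : u = (1 - a * q) * v / (1 - a * q * q ^+ j).
  by rewrite E; have := h j => hj; field.
by have := h j => hj; field; rewrite h3 h2 a0 hj.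
Qed.

(** Here the operator changes the factor [(u; q)_j] of the numerator into
    [(u q; q)_j]. *)
Lemma shift_b n a b (u := a * b * q ^+ n.+1) :
  (1 - u) *: little_qjacobi q n a (q * b) =
  little_qjacobi q n a b - u *: dilate (little_qjacobi q n a b).
Proof.
apply/polyP => j.
rewrite !(coefZ, coefB, coef_dilate) !coef_little_qjacobi.
rewrite (_ : a * (q * b) * _ = u * q); last by rewrite /u; ring.
rewrite -/u.
have E := qpoch_shift u j.
by transitivity (((1 - u) * qpoch (u * q) q j) * qpoch (q ^- n) q j /
  (qpoch (a * q) q j * qpoch q q j) * q ^+ j); [|rewrite E]; ring.
Qed.

(** The classical second-order q-difference equation, with [q x] in place of
    [x].  It is the two-term recurrence of the coefficients in operator form. *)
Lemma qdiff_eq n a b (y := little_qjacobi q n a b) :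
  (forall j, 1 - a * q * q ^+ j != 0) ->
  a *: ((1 - (b * q ^+ 2) *: 'X) * (dilate (dilate y) - dilate y))
  = (1 - q *: 'X) * (dilate y - y)
    - (q ^- n * (1 - q ^+ n) * (1 - a * b * q ^+ n.+1) * q) *: ('X * dilate y).
Proof.
move=> h; apply/polyP => j.
rewrite !mulrBl !mul1r -!scalerAl !(coefZ, coefB, coefXM, coef_dilate).
case: j => [|j] /=; first by rewrite !expr0; ring.
have qj := qq_neq0 j; have hj := h j.
have E := coefS_little_qjacobi n b hj.
rewrite -/y in E *; set z := y`_j.+1 in E *; set w := y`_j in E *.
apply/eqP; rewrite -subr_eq0; apply/eqP.
transitivity
  (- (w * ((1 - q ^- n * q ^+ j) * (1 - a * b * q ^+ n.+1 * q ^+ j) * q))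
   + z * ((1 - a * q * q ^+ j) * (1 - q * q ^+ j))); last by rewrite E; ring.
have qn : q ^+ n != 0 by rewrite expf_neq0.
by rewrite !exprS; field.
Qed.

End Identities.

(** * Locating zeros by sign changes *)

Section Zeros.
Variable R : realType.
Implicit Types (p r : {poly R}) (s t : seq R) (q a b x : R) (n j : nat).

(** With [n] sign changes on successive intervals, the intermediate value
    theorem provides [n] distinct zeros, and the bound on the size leaves no
    room for others. *)
Lemma zero_list_alternating p n (l r : nat -> R) :
  p != 0 -> (size p <= n.+1)%N ->
  (forall j, (j < n)%N -> [/\ l j < r j, 0 < (-1) ^+ j * p.[l j]
                            & (-1) ^+ j * p.[r j] < 0]) ->
  (forall j, (j.+1 < n)%N -> r j <= l j.+1) ->
  exists s, [/\ is_zero_list p s, size s = n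
              & forall j, (j < n)%N -> l j < s`_j < r j].
Proof.
move=> p0 sp sgn lr.
have /choice[f fP] : forall j, exists x, (j < n)%N -> root p x /\ l j < x < r j.
  move=> j; have [/sgn[lt_lr pl pr]|_] := ltnP j n; last by exists 0.
  have p_lr : ((- (-1) ^+ j) *: p).[l j] <= 0 <= ((- (-1) ^+ j) *: p).[r j].
    by rewrite !hornerZ !mulNr oppr_le0 oppr_ge0 !ltW.
  have [x /andP[lx xr]] := poly_ivt (ltW lt_lr) p_lr.
  rewrite rootE hornerZ mulf_eq0 oppr_eq0 signr_eq0 /= => px.
  exists x => _; split=> //; rewrite !lt_neqAle lx xr !andbT.
  apply/andP; split; apply: contraTneq px => e.
    by rewrite -e; apply: contraTneq pl => ->; rewrite mulr0 ltxx.
  by rewrite e; apply: contraTneq pr => ->; rewrite mulr0 ltxx.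
have sort_f : sorted <%R (mkseq f n).
  apply/(sortedP 0) => i; rewrite size_mkseq => ni.
  rewrite !nth_mkseq ?(ltnW ni) //.
  have [_ /andP[_ fi]] := fP _ (ltnW ni); have [_ /andP[fi1 _]] := fP _ ni.
  exact: lt_trans fi (le_lt_trans (lr _ ni) fi1).
have [uf le_f] : uniq (mkseq f n) /\ sorted <=%R (mkseq f n).
  by move: sort_f; rewrite lt_sorted_uniq_le => /andP.
have rf : all (root p) (mkseq f n).
  by apply/allP => x /mapP[i]; rewrite mem_iota => /andP[_ /fP[pi _]] ->.
exists (mkseq f n); split; [split=> // | by rewrite size_mkseq |].
  apply: all_roots_prod_XsubC; rewrite ?uniq_rootsE //.
  by apply/eqP; rewrite eqn_leq max_poly_roots // size_mkseq sp.
by move=> j jn; rewrite nth_mkseq //; have [] := fP _ jn.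
Qed.

Lemma size_zero_list p s : is_zero_list p s -> size p = (size s).+1.
Proof.
by case=> p0 _ ->; rewrite size_scale ?lead_coef_eq0 // size_prod_XsubC.
Qed.

Lemma root_zero_list p s x : is_zero_list p s -> root p x = (x \in s).
Proof.
by case=> p0 _ ->; rewrite rootZ ?lead_coef_eq0 // root_prod_XsubC.
Qed.

(** Factoring out the value at [0] leaves the product of the [1 - x / z] over
    the zeros [z]; exactly the [j] factors with [z < x] are negative. *)
Lemma sign_zero_list p s j x :
  is_zero_list p s -> 0 < p.[0] -> all (fun z => 0 < z) s -> (j <= size s)%N ->
  (forall i, (i < j)%N -> s`_i < x) ->
  (forall i, (j <= i < size s)%N -> x < s`_i) ->
  0 < (-1) ^+ j * p.[x].
Proof.
move=> [_ _ pE] p0 /all_nthP s0 js sx xs.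
have -> : p.[x] = p.[0] * \prod_(0 <= i < size s) (1 - x / s`_i).
  rewrite pE !hornerZ !horner_prod -!mulrA; congr (_ * _).
  rewrite (big_nth 0) [X in _ = X * _](big_nth 0) -big_split /=.
  apply: eq_big_nat => i /andP[_ si].
  rewrite !hornerXsubC; have := s0 0 _ si; rewrite lt0r => /andP[? _].
  by field.
rewrite (@big_cat_nat _ _ _ j) //= mulrCA mulrA mulrA mulr_gt0 //; last first.
  rewrite big_nat; apply: prodr_gt0 => i ijs; have /andP[_ si] := ijs.
  by rewrite subr_gt0 ltr_pdivrMr ?mul1r ?xs // s0.
rewrite -mulrA mulr_gt0 // -[j in _ ^+ j]subn0 -prodr_const_nat -big_split /=.
rewrite big_nat; apply: prodr_gt0 => i ij.
have si := s0 0 _ (leq_trans ij js).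
by rewrite mulN1r oppr_gt0 subr_lt0 ltr_pdivlMr ?mul1r ?sx.
Qed.

(** The mesh class with the zeros given as a list.  The mesh condition is kept
    free of division, and is exactly what places [q s_j] above [s_(j-1)]. *)
Definition mesh_zeros q p s :=
  [/\ is_zero_list p s, all (fun z => 0 < z < 1) s
    & forall j, (j.+1 < size s)%N -> s`_j < q * s`_j.+1].

Section MeshZeros.
Variables (q : R) (p : {poly R}) (s : seq R).
Hypotheses (q_gt0 : 0 < q) (q_lt1 : q < 1) (ps : mesh_zeros q p s).
Hypothesis p0 : 0 < p.[0].

Lemma mesh_zeros_itv j : (j < size s)%N -> 0 < s`_j < 1.
Proof. by case: ps => _ /all_nthP h _; exact: h. Qed.

Lemma mesh_zeros_root j : (j < size s)%N -> p.[s`_j] = 0.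
Proof.
case: ps => zs _ _ js; apply/rootP.
by rewrite (root_zero_list _ zs) mem_nth.
Qed.

Lemma mesh_zeros_le i j : (i <= j < size s)%N -> s`_i <= s`_j.
Proof.
case: ps => -[_ ss _] _ _ /andP[ij js].
apply: (sorted_leq_nth le_trans le_refl) => //.
by rewrite inE (leq_ltn_trans ij).
Qed.

Lemma mesh_zeros_mul i j : (i < j < size s)%N -> s`_i < q * s`_j.
Proof.
case: j => // j /andP[]; rewrite ltnS => ij js; case: ps => _ _ /(_ _ js).
by apply: le_lt_trans; apply: mesh_zeros_le; rewrite ij ltnW.
Qed.

Lemma mesh_zeros_gt0 : all (fun z => 0 < z) s.
Proof. by case: ps => _ + _; apply: sub_all => z /andP[]. Qed.

Lemma sign_mesh_mul j : (j < size s)%N -> 0 < (-1) ^+ j * p.[q * s`_j].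
Proof.
move=> js; have /andP[sj0 _] := mesh_zeros_itv js.
case: (ps) => zs _ _; apply: (sign_zero_list zs p0 mesh_zeros_gt0 (ltnW js)).
  by move=> i ij; apply: mesh_zeros_mul; rewrite ij.
move=> i ijs; apply: lt_le_trans (mesh_zeros_le ijs).
by rewrite gtr_pMl.
Qed.

Lemma sign_mesh_div j : (j < size s)%N -> (-1) ^+ j * p.[s`_j / q] < 0.
Proof.
move=> js; have /andP[sj0 _] := mesh_zeros_itv js.
rewrite -oppr_gt0 -mulNr -[- _ ^+ _]mulN1r -exprS.
case: (ps) => zs _ _; apply: (sign_zero_list zs p0 mesh_zeros_gt0 js) => i ij.
  have /le_lt_trans : s`_i <= s`_j 
    by apply: mesh_zeros_le; rewrite js andbT -ltnS.
  by apply; rewrite ltr_pdivlMr // gtr_pMr.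
by rewrite ltr_pdivrMr // mulrC; apply: mesh_zeros_mul.
Qed.

Lemma sign_mesh_one : 0 < (-1) ^+ size s * p.[1].
Proof.
case: (ps) => zs _ _; apply: (sign_zero_list zs p0 mesh_zeros_gt0) => // i.
  by move=> /mesh_zeros_itv/andP[].
by move=> /andP[/leq_ltn_trans h /h]; rewrite ltnn.
Qed.

Lemma mesh_zeros_class : mesh_class q (size s) `]0, 1[ p.
Proof.
case: (ps) => zs s01 sm; have dp : degree p = size s.
  by rewrite /degree (size_zero_list zs).
split=> //; first by exists s.
  move=> z; rewrite (root_zero_list _ zs) => /(allP s01).
  by rewrite /= in_itv.
move=> _; rewrite /lmesh dp; apply: bigmax_lt => // j _.
rewrite /lambda (zerosE zs).
have js : (j.+1 < size s)%N by case: (size s) j => [[]//|m j] /=; rewrite ltnS.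
by rewrite ltr_pdivrMr ?sm //; have /andP[] := mesh_zeros_itv js.
Qed.

End MeshZeros.

Lemma interlace_same p r s t :
  is_zero_list p s -> is_zero_list r t -> size t = size s ->
  (forall j, (j < size s)%N -> s`_j < t`_j) ->
  (forall j, (j.+1 < size s)%N -> t`_j < s`_j.+1) -> p ≺ r.
Proof.
move=> ps rt st h1 h2; split; [by exists s | by exists t | left].
by rewrite /degree /lambda (zerosE ps) (zerosE rt) (size_zero_list ps)
  (size_zero_list rt) st.
Qed.

Lemma interlace_lower p r s t :
  is_zero_list p s -> is_zero_list r t -> size s = (size t).+1 ->
  (forall j, (j < size t)%N -> s`_j < t`_j < s`_j.+1) -> p ≺ r.
Proof.
move=> ps rt st h; split; [by exists s | by exists t | right].
rewrite /degree /lambda (zerosE ps) (zerosE rt) (size_zero_list ps).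
by rewrite (size_zero_list rt) st; split => // j /h /andP.
Qed.

End Zeros.

(** * Zeros of little q-Jacobi polynomials *)

Section LittleQJacobi.
Variables (R : realType) (q : R).
Hypotheses (q_gt0 : 0 < q) (q_lt1 : q < 1).
Implicit Types (a b c : R) (n j : nat) (s t : seq R).

Let q_neq0 : q != 0. Proof. by rewrite gt_eqF. Qed.

Lemma subr1_mul_expr_gt0 c j : 0 < c -> c < 1 -> 0 < 1 - c * q ^+ j.
Proof.
move=> c0 c1; rewrite subr_gt0 (le_lt_trans _ c1) // ger_pMr //.
by rewrite exprn_ile1 // ltW.
Qed.

Let qq_neq0 j : 1 - q * q ^+ j != 0.
Proof. by rewrite gt_eqF ?subr1_mul_expr_gt0. Qed.

Let aq_neq0 a : 0 < a * q -> a * q < 1 -> forall j, 1 - a * q * q ^+ j != 0.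
Proof. by move=> ? ? j; rewrite gt_eqF ?subr1_mul_expr_gt0. Qed.

Lemma mul_bqq_le b x : b * q < 1 -> 0 < x -> b * q ^+ 2 * x <= q * x.
Proof.
move=> b1 x0; rewrite expr2 mulrA -mulrA ger_pMl ?ltW //; exact: mulr_gt0.
Qed.

Lemma mulq_lt1 x : 0 < x -> x < 1 -> q * x < 1.
Proof. by move=> x0 x1; rewrite mulr_ilt1 // ltW. Qed.

Lemma little_qjacobi_neq0 n a b : little_qjacobi q n a b != 0.
Proof.
apply/eqP => h; have := horner0_little_qjacobi q_neq0 n a b.
by rewrite h horner0 => /esym/eqP; rewrite oner_eq0.
Qed.

(** The sign changes give [t_j < q s_j] and [s_j < t_(j+1)].  The factor [q] in
    the first bound, stronger than interlacing, is what keeps the mesh below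
    [q]: [t_j < q s_j < q t_(j+1)]. *)
Lemma mesh_zeros_step n a b s :
  0 < a * q -> a * q < 1 -> b * q < 1 ->
  mesh_zeros q (little_qjacobi q n (q * a) (q * b)) s -> size s = n ->
  exists t, [/\ mesh_zeros q (little_qjacobi q n.+1 a b) t, size t = n.+1
    & forall j, (j < n)%N -> t`_j < s`_j < t`_j.+1].
Proof.
move=> a0 a1 b1 rs sn.
set p := little_qjacobi q n.+1 a b; set r := little_qjacobi q n _ _ in rs.
have pE y : (1 - a * q) * p.[q * y] =
    (1 - q * y) * r.[y] - a * q * (1 - b * q ^+ 2 * y) * r.[q * y].
  have := backward_shift q_neq0 qq_neq0 n b (aq_neq0 a0 a1).
  move/(congr1 (horner^~ y)).
  rewrite !(hornerE, horner_dilate) /= -/p -/r => ->.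
  by ring.
have r0 : 0 < r.[0] by rewrite horner0_little_qjacobi.
have a1' : 0 < 1 - a * q by rewrite subr_gt0.
(* One term of pE vanishes at each of the points s_j / q, s_j and 1 / q. *)
have p_s j : (j < n)%N -> (-1) ^+ j * p.[s`_j] < 0.
  rewrite -{1}sn => js; have /andP[s0 s1] := mesh_zeros_itv rs js.
  have := pE (s`_j / q); rewrite [q * _]mulrC mulfVK //.
  rewrite (mesh_zeros_root rs js) mulr0 subr0 => E.
  have h := sign_mesh_div q_gt0 q_lt1 rs r0 js.
  rewrite -(pmulr_rlt0 _ a1') mulrCA E mulrCA pmulr_rlt0 ?subr_gt0 //.
have p_qs j : (j < n)%N -> (-1) ^+ j * p.[q * s`_j] < 0.
  rewrite -{1}sn => js; have /andP[s0 s1] := mesh_zeros_itv rs js.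
  have := pE s`_j; rewrite (mesh_zeros_root rs js) mulr0 add0r => E.
  have h := sign_mesh_mul q_lt1 rs r0 js.
  rewrite -(pmulr_rlt0 _ a1') mulrCA E mulrN oppr_lt0 mulrCA pmulr_rgt0 //.
  by rewrite mulr_gt0 // subr_gt0 (le_lt_trans (mul_bqq_le b1 s0)) ?mulq_lt1.
have p_0 : 0 < p.[0] by rewrite horner0_little_qjacobi.
have p_1 : (-1) ^+ n * p.[1] < 0.
  have := pE q^-1; rewrite mulfV // subrr mul0r add0r => E.
  have := sign_mesh_one rs r0; rewrite sn => h.
  rewrite -(pmulr_rlt0 _ a1') mulrCA E mulrN oppr_lt0 mulrCA pmulr_rgt0 //.
  rewrite mulr_gt0 // expr2 -!mulrA mulfV // mulr1 subr_gt0 //.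
pose l j := (0 :: s)`_j; pose u j := if (j < n)%N then q * s`_j else 1.
have s01 j : (j < n)%N -> 0 < s`_j < 1.
  by rewrite -{1}sn => js; exact: (mesh_zeros_itv rs js).
have l0 j : (j <= n)%N -> 0 <= l j.
  by case: j => // j /s01/andP[/ltW].
have u1 j : u j <= 1.
  rewrite /u; case: ltnP => // /s01/andP[s0 s1].
  by rewrite mulr_ile1 // ltW.
have ul j : (j.+1 < n.+1)%N -> u j <= l j.+1.
  by rewrite ltnS /u => jn; rewrite jn ger_pMl ?ltW //; case/andP: (s01 _ jn).
have [|t [pt tn lu]] := zero_list_alternating (little_qjacobi_neq0 _ _ _)
  (size_little_qjacobi q n.+1 a b) _ ul.
  move=> j jn; split; last 1 first.
  - rewrite /u; case: ltnP => [/p_qs //|nj].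
    by have -> : j = n by apply/eqP; rewrite eqn_leq nj andbT -ltnS.
  - case: j jn => [|j] jn; rewrite /l /u /=.
      by case: ifP => // /s01/andP[s0 _]; rewrite mulr_gt0.
    case: ifP => [jn'|_]; last by case/andP: (s01 _ jn).
    by apply: (mesh_zeros_mul rs); rewrite ltnSn sn.
  - case: j jn => [|j] jn; first by rewrite expr0 mul1r.
    by rewrite exprS mulN1r mulNr oppr_gt0 p_s.
have t_lo j : (j < n)%N -> s`_j < t`_j.+1.
  by move=> jn; have /andP[] := lu j.+1 jn.
have t_up j : (j < n)%N -> t`_j < q * s`_j.
  by move=> jn; have /andP[_] := lu j (leqW jn); rewrite /u jn.
exists t; split=> // [|j jn].
  split=> //.
    apply/(all_nthP 0) => j; rewrite tn => jn; have /andP[lt tu] := lu _ jn.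
    by rewrite (le_lt_trans (l0 _ jn) lt) (lt_le_trans tu (u1 _)).
  move=> j; rewrite tn ltnS => jn; apply: lt_trans (t_up _ jn) _.
  by rewrite ltr_pM2l // t_lo.
rewrite t_lo // andbT; apply: lt_trans (t_up _ jn) _.
by rewrite gtr_pMl //; case/andP: (s01 _ jn).
Qed.

Lemma mesh_zeros_little_qjacobi n a b :
  0 < a * q -> a * q < 1 -> b * q < 1 ->
  exists s, mesh_zeros q (little_qjacobi q n a b) s /\ size s = n.
Proof.
elim: n a b => [|n IHn] a b a0 a1 b1.
  exists [::]; split=> //; split=> //; split=> //.
    exact: little_qjacobi_neq0.
  rewrite big_nil.
  have /size1_polyC-> := size_little_qjacobi q 0 a b.
  by rewrite lead_coefC alg_polyC.
have [|||s [rs sn]] := IHn (q * a) (q * b).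
- by rewrite -mulrA mulr_gt0.
- by rewrite -mulrA; exact: mulq_lt1.
- by rewrite -mulrA (lt_trans _ q_lt1) // gtr_pMr.
by have [t []] := mesh_zeros_step a0 a1 b1 rs sn; exists t.
Qed.

(** At a zero of [y] only two of the three values [y(x)], [y(q x)], [y(q^2 x)]
    remain in the q-difference equation, which makes them proportional. *)
Lemma qdiff_at_root n a b x (y := little_qjacobi q n a b) :
  0 < a * q -> a * q < 1 -> y.[x] = 0 ->
  a * (1 - b * q ^+ 2 * x) * y.[q * (q * x)] =
  (a * (1 - b * q ^+ 2 * x) + (1 - q * x)
   - q ^- n * (1 - q ^+ n) * (1 - a * b * q ^+ n.+1) * (q * x)) * y.[q * x].
Proof.
move=> a0 a1 yx; have := qdiff_eq q_neq0 qq_neq0 n b (aq_neq0 a0 a1).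
move/(congr1 (horner^~ x)); rewrite !(hornerE, horner_dilate) /= -/y yx => E.
by apply/eqP; rewrite -subr_eq0; apply/eqP; move/eqP: E;
  rewrite -subr_eq0 => /eqP E; rewrite -[RHS]E; ring.
Qed.

(** Let [r] be the right-hand polynomial, [A = q^2 a], [v = q x],
    [w = b q^2 x], [K = A (1 - w)] and
    [c = q^-n (1 - q^n) (1 - A b q^(n+1)) >= 0].  At a zero [x] of [r], the
    left-hand polynomial is a negative multiple of
    [((1 + q) K - A (K + (1 - v) - c v)) r(q x)].  As [w <= v] and [A < q], the
    factor of [r(q x)] is the positive sum [(q - A) K + A (v - w) + A c v]. *)
Lemma interlace_ab n a b : 0 < a * q -> a * q < 1 -> b * q < 1 ->
  little_qjacobi q n a (q ^+ 2 * b) ≺ little_qjacobi q n (q ^+ 2 * a) b.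
Proof.
move=> a0 a1 b1.
have q2 : q ^+ 2 < 1 by rewrite exprn_ilt1 // ltW.
have a_gt0 : 0 < a by rewrite -(pmulr_lgt0 _ q_gt0).
have a2_gt0 : 0 < q ^+ 2 * a * q by rewrite -mulrA mulr_gt0 // exprn_gt0.
have a2_lt1 : q ^+ 2 * a * q < 1.
  by rewrite -mulrA; apply: le_lt_trans a1; rewrite ger_pMl // ltW.
have [s [rs sn]] := mesh_zeros_little_qjacobi n a2_gt0 a2_lt1 b1.
set r := little_qjacobi q n (q ^+ 2 * a) b in rs *.
rewrite (_ : q ^+ 2 * b = q * (q * b)); last by ring.
set p := little_qjacobi q n a _.
have pE x : r.[x] = 0 -> (1 - a * q) * (1 - q * a * q) * p.[x] =
    - (a * q) * ((1 + q) * r.[q * x] - q ^+ 2 * a * r.[q * (q * x)]).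
  have h1 := shift_a q_neq0 qq_neq0 n (q * b) (aq_neq0 a0 a1).
  have [qa0 qa1] : 0 < q * a * q /\ q * a * q < 1 by split; nra.
  have h2 := shift_a q_neq0 qq_neq0 n b (aq_neq0 qa0 qa1).
  rewrite mulrA -expr2 -/r in h2; rewrite -/p in h1.
  set m := little_qjacobi q n (q * a) (q * b) in h1 h2.
  have e1 := congr1 (horner^~ x) h1; have e2 := congr1 (horner^~ x) h2.
  have e3 := congr1 (horner^~ (q * x)) h2.
  rewrite !(hornerE, horner_dilate) /= in e1 e2 e3 => rx.
  rewrite rx in e2; rewrite -(mulrA q q x) in e3.
  transitivity ((1 - q * a * q) * ((1 - a * q) * p.[x])); first by ring.
  rewrite e1.
  transitivity
    ((1 - q * a * q) * m.[x] - a * q * ((1 - q * a * q) * m.[q * x])).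
    by ring.
  by rewrite e2 e3; ring.
have r0 : 0 < r.[0] by rewrite horner0_little_qjacobi.
have p0 : 0 < p.[0] by rewrite horner0_little_qjacobi.
have p_s j : (j < n)%N -> (-1) ^+ j * p.[s`_j] < 0.
  rewrite -{1}sn => js; have /andP[s0 s1] := mesh_zeros_itv rs js.
  have rj := mesh_zeros_root rs js.
  have := sign_mesh_mul q_lt1 rs r0 js.
  have := qdiff_at_root a2_gt0 a2_lt1 rj; have := pE _ rj.
  rewrite -/r; move: (s`_j) s0 s1 => x x0 x1.
  set y := r.[q * x]; set z := r.[q * (q * x)] => Ep Er y_gt0.
  have le_x := mul_bqq_le b1 x0; have qx1 := mulq_lt1 x0 x1.
  have A_gt0 : 0 < q ^+ 2 * a by rewrite mulr_gt0 ?exprn_gt0.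
  have A_ltq : q ^+ 2 * a < q by rewrite expr2 -mulrA gtr_pMr // mulrC.
  have c_ge0 : 0 <= q ^- n * (1 - q ^+ n) * (1 - q ^+ 2 * a * b * q ^+ n.+1).
    have qn1 : q ^+ n <= 1 by rewrite exprn_ile1 // ltW.
    have qn0 : 0 < q ^+ n by rewrite exprn_gt0.
    apply: mulr_ge0; first by rewrite mulr_ge0 ?invr_ge0 ?subr_ge0 // ltW.
    rewrite subr_ge0.
    have -> : q ^+ 2 * a * b * q ^+ n.+1 = (q ^+ 2 * a * q ^+ n) * (b * q).
      by rewrite (exprS q n); ring.
    have w0 : 0 < q ^+ 2 * a * q ^+ n by rewrite mulr_gt0.
    have w1 : q ^+ 2 * a * q ^+ n < 1.
      by rewrite (le_lt_trans _ (lt_trans A_ltq q_lt1)) // ger_pMr.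
    by rewrite ltW // (lt_trans _ w1) // gtr_pMr.
  move: Ep Er; set A := q ^+ 2 * a in A_gt0 A_ltq c_ge0 *.
  set c := q ^- n * _ * _ in c_ge0 *; set w := b * q ^+ 2 * x in le_x *.
  set v := q * x in le_x qx1 *; have v0 : 0 < v by exact: mulr_gt0.
  move=> Ep Er.
  set K := A * (1 - w) in Er.
  have K_gt0 : 0 < K by rewrite mulr_gt0 // subr_gt0; lra.
  have B_gt0 : 0 < (1 + q) * K - A * (K + (1 - v) - c * v).
    have h1 : 0 <= A * (v - w) by rewrite mulr_ge0 ?subr_ge0 // ltW.
    have h2 : 0 <= A * (c * v).
      exact: mulr_ge0 (ltW A_gt0) (mulr_ge0 c_ge0 (ltW v0)).
    have h3 : 0 < (q - A) * K by rewrite mulr_gt0 // subr_gt0.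
    have -> : (1 + q) * K - A * (K + (1 - v) - c * v) =
      (q - A) * K + A * (v - w) + A * (c * v) by rewrite /K; ring.
    by lra.
  have D_gt0 : 0 < (1 - a * q) * (1 - q * a * q) * K.
    by rewrite mulr_gt0 // mulr_gt0 ?subr_gt0 // -mulrA mulq_lt1.
  rewrite -(pmulr_rlt0 _ D_gt0).
  have -> : (1 - a * q) * (1 - q * a * q) * K * ((-1) ^+ j * p.[x]) =
      - (a * q * ((1 + q) * K - A * (K + (1 - v) - c * v)) * ((-1) ^+ j * y)).
    transitivity ((-1) ^+ j * K * ((1 - a * q) * (1 - q * a * q) * p.[x])).
      by ring.
    rewrite Ep.
    transitivity ((-1) ^+ j * - (a * q) * ((1 + q) * K * y - A * (K * z))).
      by ring.
    by rewrite Er; ring.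
  by rewrite oppr_lt0 mulr_gt0 // mulr_gt0.
pose l j := (0 :: s)`_j.
have [|t [pt tn lu]] := @zero_list_alternating _ p n l (fun j => s`_j)
  (little_qjacobi_neq0 _ _ _) (size_little_qjacobi _ _ _ _) _
  (fun j _ => lexx _).
  move=> j jn; split; last by exact: p_s.
    case: j jn => [|j] jn; rewrite /l /=.
      by have /andP[] : 0 < s`_0 < 1 by apply: (mesh_zeros_itv rs); rewrite sn.
    have jn' : (j < n)%N by exact: ltnW.
    rewrite (lt_trans (mesh_zeros_mul (j := j.+1) rs _)) ?sn ?ltnSn ?jn //.
    have /andP[s0 _] : 0 < s`_j.+1 < 1.
      by apply: (mesh_zeros_itv rs); rewrite sn.
    by rewrite gtr_pMl.
  case: j jn => [|j] jn; first by rewrite expr0 mul1r.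
  by rewrite exprS mulN1r mulNr oppr_gt0 p_s // ltnW.
case: (rs) => zs _ _; apply: (interlace_same pt zs); rewrite ?sn ?tn //.
  by move=> j /lu/andP[].
by move=> j /lu/andP[].
Qed.

(** Let [r] be the left-hand polynomial, [v = - a b q^(n+1) > 0],
    [K = a (1 - b q^2 x)], and [M] the factor with [K r(q^2 x) = M r(q x)] at a
    zero [x] of [r].  There the right-hand polynomial is a positive multiple of
    [((1 + q) K + v q M) r(q x)].  With [Q = q^-n] and [w = q x], the only
    negative term of [v q M] is [- v q Q w]; it cancels against [K], which is
    [a + v Q w].  The last zero comes from the sign at [1], which is known
    because the right-hand polynomial is in the mesh class too. *)
Lemma interlace_b n a b : 0 < a * q -> a * q < 1 -> b < 0 ->
  little_qjacobi q n a b ≺ little_qjacobi q n a (q ^+ 2 * b).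
Proof.
move=> a0 a1 b0.
have a_gt0 : 0 < a by rewrite -(pmulr_lgt0 _ q_gt0).
have b1 : b * q < 1 by nra.
have [s [rs sn]] := mesh_zeros_little_qjacobi n a0 a1 b1.
set r := little_qjacobi q n a b in rs *.
have b2 : q ^+ 2 * b * q < 1.
  by rewrite (lt_trans _ (@ltr01 R)) // pmulr_llt0 // pmulr_rlt0 // exprn_gt0.
have [s' [ps' sn']] := mesh_zeros_little_qjacobi n a0 a1 b2.
move: ps'; rewrite (_ : q ^+ 2 * b = q * (q * b)); last by ring.
set p := little_qjacobi q n a (q * _) => ps'.
pose v := - (a * b * q ^+ n.+1).
have v_gt0 : 0 < v by rewrite oppr_gt0 pmulr_llt0 ?exprn_gt0 // pmulr_rlt0.
have pE x : r.[x] = 0 -> (1 + v) * (1 + v * q) * p.[x] =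
    v * ((1 + q) * r.[q * x] + v * q * r.[q * (q * x)]).
  have h1 := shift_b q_neq0 n a b.
  have h2 := shift_b q_neq0 n a (q * b).
  have vq : a * (q * b) * q ^+ n.+1 = - v * q by rewrite /v; ring.
  rewrite vq -/p in h2.
  rewrite -[a * b * _]opprK -/v -/r in h1.
  set m := little_qjacobi q n a (q * b) in h1 h2.
  have e1 := congr1 (horner^~ x) h1; have e2 := congr1 (horner^~ x) h2.
  have e3 := congr1 (horner^~ (q * x)) h1.
  rewrite !(hornerE, horner_dilate) /= in e1 e2 e3 => rx.
  rewrite rx in e1; rewrite -(mulrA q q x) in e3.
  transitivity ((1 + v) * ((1 + v * q) * p.[x])); first by ring.
  have -> : (1 + v * q) * p.[x] = m.[x] + v * q * m.[q * x].
    transitivity (m.[x] - - v * q * m.[q * x]); last by ring.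
    by rewrite -e2; ring.
  transitivity ((1 + v) * m.[x] + v * q * ((1 + v) * m.[q * x])); first by ring.
  move: e1 e3; rewrite !opprK => -> ->; rewrite /v; ring.
have r0 : 0 < r.[0] by rewrite horner0_little_qjacobi.
have p0 : 0 < p.[0] by rewrite horner0_little_qjacobi.
have p_s j : (j < n)%N -> 0 < (-1) ^+ j * p.[s`_j].
  rewrite -{1}sn => js; have /andP[s0 s1] := mesh_zeros_itv rs js.
  have rj := mesh_zeros_root rs js.
  have := sign_mesh_mul q_lt1 rs r0 js.
  have := qdiff_at_root a0 a1 rj; have := pE _ rj.
  rewrite -/r; move: (s`_j) s0 s1 => x x0 x1.
  set y := r.[q * x]; set z := r.[q * (q * x)] => Ep Er y_gt0.
  have qx1 := mulq_lt1 x0 x1.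
  have qn0 : 0 < q ^+ n by rewrite exprn_gt0.
  pose Q := (q ^+ n)^-1.
  have Q_gt0 : 0 < Q by rewrite invr_gt0.
  pose w := q * x; have w0 : 0 < w by exact: mulr_gt0.
  pose K := a + v * Q * w.
  have KE : a * (1 - b * q ^+ 2 * x) = K.
    by rewrite /K /v /Q /w (exprS q n); field; rewrite gt_eqF.
  pose M := a + 1 + v * w - Q * w.
  have ME : a * (1 - b * q ^+ 2 * x) + (1 - q * x) -
      q ^- n * (1 - q ^+ n) * (1 - a * b * q ^+ n.+1) * (q * x) = M.
    by rewrite KE /M /K /v /Q /w (exprS q n); field; rewrite gt_eqF.
  rewrite ME KE in Er.
  have K_gt0 : 0 < K by rewrite addr_gt0 // !mulr_gt0.
  have B_gt0 : 0 < (1 + q) * K + v * q * M.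
    have -> : (1 + q) * K + v * q * M =
        (1 + q) * a + v * Q * w + v * q * (a + 1 + v * w).
      by rewrite /K /M; ring.
    by rewrite !addr_gt0 ?mulr_gt0 ?addr_gt0 ?mulr_gt0.
  have D_gt0 : 0 < (1 + v) * (1 + v * q) * K.
    by rewrite !mulr_gt0 ?addr_gt0 ?mulr_gt0.
  rewrite -(pmulr_rgt0 _ D_gt0).
  have -> : (1 + v) * (1 + v * q) * K * ((-1) ^+ j * p.[x]) =
      v * ((1 + q) * K + v * q * M) * ((-1) ^+ j * y).
    transitivity ((-1) ^+ j * K * ((1 + v) * (1 + v * q) * p.[x])).
      by ring.
    rewrite Ep.
    transitivity ((-1) ^+ j * v * ((1 + q) * K * y + v * q * (K * z))).
      by ring.
    by rewrite Er; ring.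
  by rewrite mulr_gt0 // mulr_gt0.
(* The default value 1 is the right end of the last interval. *)
pose u j := nth 1 s j.+1.
have uE j : (j.+1 < n)%N -> u j = s`_j.+1.
  by rewrite -sn => js; apply: set_nth_default.
have ul j : (j.+1 < n)%N -> u j <= s`_j.+1 by move/uE->.
have [|t [pt tn lu]] := @zero_list_alternating _ p n (fun j => s`_j) u
  (little_qjacobi_neq0 _ _ _) (size_little_qjacobi _ _ _ _) _ ul.
  move=> j jn; have sj : 0 < s`_j < 1 by apply: (mesh_zeros_itv rs); rewrite sn.
  have /andP[sj0 sj1] := sj; split; [|exact: p_s|].
    have [jn'|nj] := ltnP j.+1 n; last by rewrite /u (nth_default 1) ?sn.
    rewrite uE //.
    rewrite (lt_trans (mesh_zeros_mul (j := j.+1) rs _)) ?sn ?ltnSn ?jn' //.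
    have /andP[s1 _] : 0 < s`_j.+1 < 1.
      by apply: (mesh_zeros_itv rs); rewrite sn.
    by rewrite gtr_pMl.
  have -> : (-1) ^+ j = - (-1) ^+ j.+1 :> R by rewrite exprS mulN1r opprK.
  rewrite mulNr oppr_lt0.
  have [jn'|nj] := ltnP j.+1 n; first by rewrite uE ?p_s.
  have -> : j.+1 = size s' by apply/eqP; rewrite sn' eqn_leq jn.
  rewrite /u (nth_default 1) ?sn //; exact: sign_mesh_one ps' p0.
case: (rs) => zs _ _; apply: (interlace_same zs pt); rewrite ?sn ?tn //.
  by move=> j /lu/andP[].
by move=> j jn; have /andP[_] := lu j (ltnW jn); rewrite uE.
Qed.

End LittleQJacobi.

Theorem theorem3p2 (R : realType) (q : R) (n : nat) (a b : R)
    (q_gt0 : 0 < q) (q_lt1 : q < 1) (n_ge1 : (1 <= n)%N)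
    (aq_gt0 : 0 < a * q) (aq_lt1 : a * q < 1) (bq_lt1 : b * q < 1) :
  mesh_class q n `]0, 1[ (little_qjacobi q n a b)
  /\ little_qjacobi q n a b ≺ little_qjacobi q n.-1 (q * a) (q * b)
  /\ little_qjacobi q n a (q ^+ 2 * b) ≺ little_qjacobi q n (q ^+ 2 * a) b
  /\ (b < 0 -> little_qjacobi q n a b ≺ little_qjacobi q n a (q ^+ 2 * b)).
Proof.
have qa_gt0 : 0 < q * a * q by rewrite -mulrA mulr_gt0.
have qa_lt1 : q * a * q < 1 by rewrite -mulrA mulq_lt1.
have qb_lt1 : q * b * q < 1 by rewrite -mulrA (lt_trans _ q_lt1) // gtr_pMr.
case: n n_ge1 => // n _.
have [s [rs sn]] :=
  mesh_zeros_little_qjacobi q_gt0 q_lt1 n qa_gt0 qa_lt1 qb_lt1.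
have [t [pt tn ts]] := mesh_zeros_step q_gt0 q_lt1 aq_gt0 aq_lt1 bq_lt1 rs sn.
split; first by have := mesh_zeros_class q_gt0 pt; rewrite tn.
split.
  case: pt rs => pt _ _ [rs _ _].
  by apply: (interlace_lower pt rs); rewrite sn ?tn.
by split; [exact: interlace_ab | exact: interlace_b].
Qed.
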